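(* Fix integers $k \ge 3$ and $i \in \{2, \dots, k-1\}$, and let $T$ be the tile $\{1,\dots,k\} \setminus \{i\} \subset \mathbb{Z}$. Then $T$ tiles $\mathbb{Z}^d$ for some $d$.
   Context: For $d \ge 1$, regard $T \subset \mathbb{Z}$ as a subset of $\mathbb{Z}^d$ via $x \mapsto (x,0,\dots,0)$. A copy of $T$ in $\mathbb{Z}^d$ is a subset of $\mathbb{Z}^d$ isometric to $T$ (Euclidean metric). $T$ tiles $\mathbb{Z}^d$ means $\mathbb{Z}^d$ can be partitioned into copies of $T$. *)

(* Defs.v *)
From mathcomp Require Import all_boot all_order all_algebra.
Unset Printing Implicit Defensive.
Import Order.TTheory GRing.Theory Num.Theory.
Local Open Scope ring_scope.

Definition pt (d : nat) := {ffun 'I_d -> int}.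

(* Squared Euclidean distance (distance = its square root, so preserving
   one is the same as preserving the other). *)
Definition sqdist (d : nat) (x y : pt d) : int := \sum_(j < d) (x j - y j) ^+ 2.

Definition emb (d : nat) (x : int) : pt d := [ffun j : 'I_d => if val j == 0%N then x else 0].

Definition isometric (d : nat) (A B : pt d -> Prop) : Prop :=
  exists f : pt d -> pt d,
    [/\ (forall x, A x -> B (f x)),
        (forall y, B y -> exists x, A x /\ f x = y) &
        (forall x y, A x -> A y -> sqdist d (f x) (f y) = sqdist d x y)].

Definition embset (d : nat) (T : int -> Prop) : pt d -> Prop :=
  fun p => exists x, T x /\ p = emb d x.

Definition copy_of (d : nat) (T : int -> Prop) (S : pt d -> Prop) : Prop :=
  isometric d (embset d T) S.

Definition tiles (d : nat) (T : int -> Prop) : Prop :=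
  exists C : (pt d -> Prop) -> Prop,
    (forall S, C S -> copy_of d T S) /\
    (forall p : pt d, exists S, C S /\ S p) /\
    (forall p : pt d, forall S S', C S -> C S' -> S p -> S' p -> S = S').

Definition tile (k i : nat) : int -> Prop :=
  fun x => (1 <= x <= k%:Z) /\ x <> i%:Z.

(* Main.v *)
Require Import Defs.
From mathcomp Require Import all_boot all_order all_algebra.
From mathcomp Require Import zify ring.
From Stdlib Require Import IndefiniteDescription.

Import Order.TTheory GRing.Theory Num.Theory.
Local Open Scope ring_scope.

(* Copies of the tile along an axis, started at all heights of one residue class mod k,
   cover a line except for one residue class. Hence, working mod k, every cube minus one
   residue class is tileable: puncture all lines of one direction at the same coordinate
   and recurse in the hyperplane of holes. If a set J of classes with #|J| = 1 mod (k-1)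
   is split by some coordinate into k layers of sizes again 1 mod (k-1), the layers can be
   treated separately; this is always possible for points such that every function to
   {0, ..., k-1} occurs among their coordinates. One further coordinate, the height, is
   filled by vertical copies standing over these points: the number of them meeting height
   n must be 1 mod (k-1), which is a linear recurrence mod (k-1), solvable on all of Z. *)

(** * Tileable subsets of the lattice *)

Definition tileable (d : nat) (T : int -> Prop) (A : pt d -> Prop) : Prop :=
  exists C : (pt d -> Prop) -> Prop,
    [/\ forall S, C S -> copy_of d T S,
        forall S p, C S -> S p -> A p,
        forall p, A p -> exists S, C S /\ S p &
        forall p S S', C S -> C S' -> S p -> S' p -> S = S'].

Lemma tileable_ext {d T} (A B : pt d -> Prop) :
  (forall p, A p <-> B p) -> tileable d T A -> tileable d T B.
Proof.
move=> AB [C [C1 C2 C3 C4]]; exists C; split=> // [S p CS Sp|p /AB]; last exact: C3.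
by apply/AB; apply: C2 CS Sp.
Qed.

Lemma tileable_bigU {d T} {I : Type} (A : I -> pt d -> Prop) :
  (forall c c' p, A c p -> A c' p -> c = c') ->
  (forall c, tileable d T (A c)) -> tileable d T (fun p => exists c, A c p).
Proof.
move=> disjA /functional_choice[C CP].
exists (fun S => exists c, C c S); split.
- by move=> S [c]; have [C1 _ _ _] := CP c; apply: C1.
- move=> S p [c CS] Sp; exists c; have [_ C2 _ _] := CP c; exact: C2 CS Sp.
- move=> p [c Ap]; have [_ _ C3 _] := CP c.
  by have [S [CS Sp]] := C3 p Ap; exists S; split=> //; exists c.
- move=> p S S' [c CS] [c' CS'] Sp S'p.
  have [_ C2 _ C4] := CP c; have [_ C2' _ _] := CP c'.
  have Ecc' := disjA _ _ _ (C2 _ _ CS Sp) (C2' _ _ CS' S'p); subst c'.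
  exact: C4 CS CS' Sp S'p.
Qed.

Lemma tileableU {d T} (A B : pt d -> Prop) :
  (forall p, A p -> ~ B p) -> tileable d T A -> tileable d T B ->
  tileable d T (fun p => A p \/ B p).
Proof.
move=> disjAB tA tB.
apply: (tileable_ext (fun p => exists b : bool, (if b then A else B) p)).
  by move=> p; split=> [[[]]|[|]]; [left | right | exists true | exists false].
apply: tileable_bigU => [[] [] p //|[] //].
- by move=> Ap Bp; case: (disjAB p).
- by move=> Bp Ap; case: (disjAB p).
Qed.

Lemma tileableT {d T} : tileable d T (fun=> True) -> tiles d T.
Proof.
by move=> [C [C1 _ C3 C4]]; exists C; split=> //; split=> [p|]; [apply: C3 | apply: C4].
Qed.

Definition axis_copy {d : nat} (T : int -> Prop) (j : 'I_d) (b p : pt d) : Prop :=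
  (forall l, l != j -> p l = b l) /\ T (p j - b j).

Lemma axis_copyP {d T} (j : 'I_d) b : copy_of d T (axis_copy T j b).
Proof.
have d0 : (0 < d)%N by apply: leq_ltn_trans (leq0n j) _.
pose o := Ordinal d0.
(* The embedded tile lives on coordinate [o]; its value is transferred to direction [j]. *)
exists (fun q => [ffun l => if l == j then b j + q o else b l]); split.
- move=> _ [x [Tx ->]]; split=> [l /negPf lj|]; rewrite !ffunE ?lj //.
  by rewrite eqxx /= addrC addKr.
- move=> y [yb Ty]; exists (emb d (y j - b j)); split; first by exists (y j - b j).
  apply/ffunP=> l; rewrite !ffunE /=; case: eqP => [->|/eqP/yb //].
  by rewrite addrC subrK.
- move=> _ _ [x [_ ->]] [y [_ ->]]; rewrite /sqdist.
  rewrite (bigD1 j) //= [RHS](bigD1 o) //= !big1 => [|l lo|l /negPf lj].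
  + by rewrite !ffunE eqxx /= opprD addrACA subrr add0r.
  + rewrite !ffunE; suff /negPf-> : val l != 0%N by rewrite subrr.
    by apply: contraNneq lo => l0; apply/eqP/val_inj.
  + by rewrite !ffunE lj subrr.
Qed.

Lemma tileable_axis_copies {d T} (j : 'I_d) (P : pt d -> Prop) :
  (forall p b b', P b -> P b' -> axis_copy T j b p -> axis_copy T j b' p -> b = b') ->
  tileable d T (fun p => exists b, P b /\ axis_copy T j b p).
Proof.
move=> disjP; exists (fun S => exists b, P b /\ S = axis_copy T j b); split.
- by move=> _ [b [_ ->]]; apply: axis_copyP.
- by move=> _ p [b [Pb ->]] Sp; exists b.
- by move=> p [b [Pb Sp]]; exists (axis_copy T j b); split=> //; exists b.
- by move=> p _ _ [b [Pb ->]] [b' [Pb' ->]] Sp Sp'; rewrite (disjP p b b').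
Qed.

(** * Coordinate slices and residue classes *)

Definition upd {d} (p : pt d) (j : 'I_d) (z : int) : pt d :=
  [ffun l => if l == j then z else p l].

Lemma upd_same {d} (p : pt d) j z : upd p j z j = z.
Proof. by rewrite ffunE eqxx. Qed.

Lemma upd_other {d} (p : pt d) j z l : l != j -> upd p j z l = p l.
Proof. by move=> /negPf lj; rewrite ffunE lj. Qed.

(** The affine sublattice through [v] with free directions [E]; modulo [k] it becomes a finite
    cube. *)
Definition cube {d} (E : {set 'I_d}) (v p : pt d) : bool :=
  [forall l, (l \notin E) ==> (p l == v l)].

Lemma cubeP {d} (E : {set 'I_d}) (v p : pt d) :
  reflect (forall l, l \notin E -> p l = v l) (cube E v p).
Proof.
apply: (iffP forallP) => [H l lE|H l]; first by have /implyP/(_ lE)/eqP := H l.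
by apply/implyP=> /H->.
Qed.

Definition cong_on {d} (k : nat) (E : {set 'I_d}) (w p : pt d) : bool :=
  [forall l in E, (p l == w l %[mod k%:Z])%Z].

Lemma cong_onP {d} k (E : {set 'I_d}) (w p : pt d) :
  reflect (forall l, l \in E -> (p l = w l %[mod k%:Z])%Z) (cong_on k E w p).
Proof.
apply: (iffP forallP) => [H l lE|H l]; first by have /implyP/(_ lE)/eqP := H l.
by apply/implyP=> /H->.
Qed.

Lemma eq_modz_small (k : nat) (a b : int) :
  (a = b %[mod k%:Z])%Z -> `|a - b| < k%:Z -> a = b.
Proof.
move=> /eqP; rewrite eqz_mod_dvd => /dvdzP[q Eab]; rewrite Eab => ltk.
suff q0 : q = 0 by apply/eqP; rewrite -subr_eq0 Eab q0 mul0r.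
have [q_gt0|q_lt0|->//] := ltgtP q 0; nia.
Qed.

(** Slicing in direction [j]: each layer is again a cube with one free direction fewer, which drives
    the inductions on [E] below. *)
Lemma cube_layer {d} (E : {set 'I_d}) (v p : pt d) j :
  j \in E -> cube (E :\ j) (upd v j (p j)) p = cube E v p.
Proof.
move=> jE; apply/cubeP/cubeP=> H l.
  move=> lE; have lj : l != j by apply: contraNneq lE => ->.
  by rewrite H ?upd_other // !inE negb_and lE orbT.
rewrite !inE negb_and negbK; have [-> _|lj /= lE] := eqVneq l j.
  by rewrite upd_same.
by rewrite upd_other ?H.
Qed.

Lemma cong_on_layer {d} k (E : {set 'I_d}) (w p : pt d) j :
  j \in E -> cong_on k E w p = (p j == w j %[mod k%:Z])%Z && cong_on k (E :\ j) w p.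
Proof.
move=> jE; apply/cong_onP/andP=> [H|[/eqP Hj /cong_onP H] l lE].
  by split; [apply/eqP/H | apply/cong_onP=> l /setD1P[_ lE]; apply: H].
by have [->|lj] := eqVneq l j; last by apply: H; rewrite !inE lj.
Qed.

(** * Punctured lines and cubes minus one class *)

Lemma tile_start_inj {k i} {x b b' : int} :
  tile k i (x - b) -> tile k i (x - b') -> (b = b' %[mod k%:Z])%Z -> b = b'.
Proof. by move=> [xb _] [xb' _] /eq_modz_small; apply; lia. Qed.

(** The missing position of a copy started at [b] is [b + i], in the class of [r]; every other
    position differs from it by less than [k]. *)
Lemma tile_residue {k i} {x b r : int} :
  (0 < i <= k)%N -> tile k i (x - b) -> (b = r - i%:Z %[mod k%:Z])%Z ->
  (x <> r %[mod k%:Z])%Z.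
Proof.
move=> ik [xb xi] Eb Ex; apply: xi; apply: (@eq_modz_small k); last by lia.
by rewrite -modzDml Ex -modzDmr -modzNm Eb modzNm modzDm; congr (modz _ _); ring.
Qed.

Lemma tile_start_exists {k i} {x r : int} :
  (0 < i <= k)%N -> (x <> r %[mod k%:Z])%Z ->
  exists2 b, (b = r - i%:Z %[mod k%:Z])%Z & tile k i (x - b).
Proof.
(* [b] is the largest integer below [x] in the class of [r - i], so [x - b] lies between 1 and
   [k]. *)
move=> ik Nx; pose y := x - 1 - (r - i%:Z); pose b := x - 1 - (y %% k%:Z)%Z.
have Eb : (b = r - i%:Z %[mod k%:Z])%Z.
  apply/eqP; rewrite eqz_mod_dvd; apply/dvdzP; exists (y %/ k%:Z)%Z.
  by have := divz_eq y k%:Z; rewrite /b /y; lia.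
have y0 : 0 <= (y %% k%:Z)%Z by apply: modz_ge0; lia.
have yk : (y %% k%:Z)%Z < k%:Z by apply: ltz_pmod; lia.
exists b => //; split; first by rewrite /b; lia.
move=> Ei; apply: Nx; have -> : x = b + i%:Z by lia.
by rewrite -modzDml Eb modzDml subrK.
Qed.

Lemma tileable_residue_lines {d} k i (j : 'I_d) (r : int) (P : pt d -> Prop) :
  (0 < i <= k)%N -> (forall p z, P p -> P (upd p j z)) ->
  tileable d (tile k i) (fun p => P p /\ (p j <> r %[mod k%:Z])%Z).
Proof.
move=> ik Pupd.
pose Q b := P b /\ (b j = r - i%:Z %[mod k%:Z])%Z.
apply: (tileable_ext (fun p => exists b, Q b /\ axis_copy (tile k i) j b p)); last first.
  apply: tileable_axis_copies => p b b' [_ Eb] [_ Eb'] [pb tb] [pb' tb'].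
  apply/ffunP=> l; have [->|lj] := eqVneq l j; last by rewrite -pb ?pb'.
  by apply: tile_start_inj tb tb' _; rewrite Eb Eb'.
move=> p; split.
  move=> [b [[Pb Eb] [pb tb]]]; split; last exact: tile_residue ik tb Eb.
  have -> : p = upd b j (p j); last exact: Pupd.
  by apply/ffunP=> l; rewrite ffunE; case: eqP => [->//|/eqP/pb].
move=> [Pp /(tile_start_exists ik)[z Ez tz]].
exists (upd p j z); split; first by split; [apply: Pupd | rewrite upd_same].
split=> [l lj|]; first by rewrite upd_other.
by rewrite upd_same.
Qed.

Lemma tileable_cubeD1 {d} k i (E : {set 'I_d}) (v w : pt d) :
  (0 < i <= k)%N ->
  tileable d (tile k i) (fun p => cube E v p && ~~ cong_on k E w p).
Proof.
move=> ik; move En : #|E| => n; elim: n => [|n IHn] in E En v *.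
  exists (fun=> False); split=> // p /andP[_ /cong_onP[]].
  by move=> l; rewrite (cards0_eq En) inE.
have /card_gt0P[j jE] : (0 < #|E|)%N by rewrite En.
(* [A z] is the layer at [j]-coordinate [z] minus its own class, tileable by induction. The holes of
   all layers line up in direction [j] and form [L], a union of full lines, each to be punctured at
   the class of [w j]. *)
pose A z p := cube (E :\ j) (upd v j z) p && ~~ cong_on k (E :\ j) w p.
pose L p := cube E v p && cong_on k (E :\ j) w p.
have AE z p : A z p -> p j = z.
  by case/andP=> /cubeP/(_ j); rewrite !inE eqxx upd_same => ->.
have AcE p : (exists z, A z p) <-> cube E v p && ~~ cong_on k (E :\ j) w p.
  by split=> [[z Az]|]; [move: (Az); rewrite -(AE _ _ Az) | exists (p j)]; rewrite /A cube_layer.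
apply: (tileable_ext (fun p => (exists z, A z p) \/ (L p /\ (p j <> w j %[mod k%:Z])%Z))).
  move=> p; rewrite AcE /L (cong_on_layer _ _ _ _ _ jE) negb_and.
  split=> [[/andP[-> ->]|[/andP[-> ->] /eqP->]]|/andP[->]]; rewrite ?orbT //=.
  by case: cong_on => //=; [rewrite orbF => /eqP; right | left].
apply: tileableU.
- by move=> p /AcE/andP[_ /negPf H] [/andP[_]]; rewrite H.
- apply: tileable_bigU => [z z' p /AE<- /AE<- //|z].
  by apply: IHn; move: En; rewrite (cardsD1 j E) jE => -[].
- apply: tileable_residue_lines => // p z /andP[/cubeP cp /cong_onP wp].
  apply/andP; split; [apply/cubeP=> l lE | apply/cong_onP=> l /setD1P[lj lE]].
    by rewrite upd_other ?cp //; apply: contraNneq lE => ->.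
  by rewrite upd_other // wp // !inE lj.
Qed.

(** * Cubes minus several classes *)

Lemma split_card_fibers (I : finType) (J : {set I}) (K q : nat) :
  #|J| = (q.+1 * K).+1 ->
  exists f : I -> 'I_K.+1, forall c,
    exists2 q', (q' <= q)%N & #|[set x in J | f x == c]| = (q' * K).+1.
Proof.
move=> cardJ; have /card_gt0P[x0 Jx0] : (0 < #|J|)%N by rewrite cardJ.
pose e := enum J; have size_e : size e = #|J| by rewrite cardE.
have mem_e x : (x \in e) = (x \in J) by rewrite mem_enum.
(* The first [K] elements of the enumeration form singleton fibers; the other [q * K + 1] share the
   value [K]. *)
exists (fun x => inord (minn (index x e) K)) => c.
have fE x : ((inord (minn (index x e) K) : 'I_K.+1) == c) = (minn (index x e) K == c)%N.
  by rewrite -val_eqE /= inordK // ltnS geq_minr.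
have [cK|] := ltnP c K.
  exists 0%N; rewrite // mul0n (_ : finset _ = [set nth x0 e c]) ?cards1 //.
  have ce : (c < size e)%N by rewrite size_e cardJ; nia.
  apply/setP=> x; rewrite !inE fE -mem_e; apply/andP/eqP => [[xe /eqP minE]|->].
    by rewrite -[x in LHS](nth_index x0 xe); congr nth; lia.
  by rewrite mem_nth // index_uniq ?enum_uniq //; split=> //; apply/eqP; lia.
move=> Kc; have {Kc} Ec : c = K :> nat by have := ltn_ord c; lia.
exists q => //; rewrite (_ : finset _ = J :\: [set x in take K e]); last first.
  apply/setP=> x; rewrite !inE fE Ec andbC; case Jx: (x \in J); rewrite ?andbF //.
  by rewrite in_take ?mem_e // -leqNgt !andbT; apply/eqP/idP; lia.
rewrite cardsDS; last by apply/subsetP=> x; rewrite inE => /mem_take; rewrite mem_e.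
rewrite cardsE (card_uniqP (take_uniq _ (enum_uniq _))) size_take -/e size_e cardJ.
by case: ltnP; nia.
Qed.

Lemma tileable_cubeD {d K i} {I : finType} (s : I -> pt d) (E : {set 'I_d})
    (v : pt d) (J : {set I}) (q : nat) :
  (0 < i <= K.+1)%N -> (0 < K)%N ->
  (forall f : I -> 'I_K.+1, exists j, forall x, s x j = (f x)%:Z) ->
  (forall j, j \notin E -> {in J &, forall x y, s x j = s y j}) ->
  #|J| = (q * K).+1 ->
  tileable d (tile K.+1 i)
    (fun p => cube E v p && [forall x in J, ~~ cong_on K.+1 E (s x) p]).
Proof.
move=> iK K0 s_univ; elim/ltn_ind: q => -[_|q IHq] in E v J *.
  move=> _ /eqP/cards1P[x ->]; apply: tileable_ext (tileable_cubeD1 _ _ E v (s x) iK) => p.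
  suff -> : [forall y in [set x], ~~ cong_on K.+1 E (s y) p] = ~~ cong_on K.+1 E (s x) p by [].
  apply/forall_inP/idP => [|H y /set1P-> //]; apply; exact: set11.
move=> Econst /split_card_fibers[f fP]; have [j sj] := s_univ f.
have jE : j \in E.
  (* Otherwise [f] would be constant on [J], whereas its fibers over 0 and [K] are both nonempty. *)
  apply: contraT => /Econst constj.
  have [q0 _ /eqP] := fP ord0; have [q1 _ /eqP] := fP ord_max.
  have [->|[x]] := set_0Vmem [set x in J | f x == ord0]; first by rewrite cards0.
  have [->|[y]] := set_0Vmem [set x in J | f x == ord_max]; first by rewrite cards0.
  rewrite !inE => /andP[Jy /eqP fy] /andP[Jx /eqP fx].
  by have := constj x y Jx Jy; rewrite !sj fx fy /=; lia.
(* In the layer at [z], only classes whose [j]-coordinate is congruent to [z] are present, and these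
   form one fiber of [f]. *)
pose Jz (z : int) := [set x in J | (s x j == z %[mod K.+1%:Z])%Z].
pose A z p := cube (E :\ j) (upd v j z) p &&
  [forall x in Jz z, ~~ cong_on K.+1 (E :\ j) (s x) p].
have AE z p : A z p -> p j = z.
  by case/andP=> /cubeP/(_ j); rewrite !inE eqxx upd_same => ->.
apply: (tileable_ext (fun p => exists z, A z p)) => [p|].
  suff AjE : A (p j) p = cube E v p && [forall x in J, ~~ cong_on K.+1 E (s x) p].
    by rewrite -AjE; split=> [[z Az]|]; [rewrite (AE _ _ Az) | exists (p j)].
  rewrite /A cube_layer //; congr (_ && _); apply/forall_inP/forall_inP => H x.
    move=> Jx; rewrite (cong_on_layer _ _ _ _ j) // negb_and -implybE; apply/implyP=> Ex.
    by apply: H; rewrite inE Jx eq_sym.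
  by rewrite inE => /andP[/H]; rewrite (cong_on_layer _ _ _ _ j) // negb_and eq_sym => /orP[/negPf->|].
apply: tileable_bigU => [z z' p /AE<- /AE<- //|z].
have z0 : 0 <= (z %% K.+1)%Z by exact: modz_ge0.
have zK : (z %% K.+1)%Z < K.+1%:Z by exact: ltz_pmod.
pose c : 'I_K.+1 := inord `|(z %% K.+1)%Z|%N.
have JzE : Jz z = [set x in J | f x == c].
  apply/setP=> x; rewrite !inE sj modz_small ?ltz_nat ?ltn_ord //.
  by rewrite -val_eqE /= inordK; lia.
have [q' q'q cardJ] := fP c; apply: (IHq q'); rewrite ?JzE //.
move=> l; rewrite !inE negb_and negbK => /orP[/eqP->|/Econst lJ] x y; rewrite !inE.
  by move=> /andP[_ /eqP fx] /andP[_ /eqP fy]; rewrite !sj fx fy.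
by move=> /andP[Jx _] /andP[Jy _]; apply: lJ.
Qed.

Lemma universal_points (I : finType) (K : nat) :
  exists (d : nat) (s : I -> pt d.+1),
    (forall x, s x ord0 = 0) /\
    (forall f : I -> 'I_K.+1, exists j, forall x, s x j = (f x)%:Z).
Proof.
pose F := {ffun I -> 'I_K.+1}.
(* One coordinate per function, plus [ord0], kept at 0 to serve later as the height. *)
exists #|{: F}|, (fun x => [ffun j => if unlift ord0 j is Some l then
  ((enum_val l : F) x)%:Z else 0]); split=> [x|f].
  by rewrite ffunE unlift_none.
exists (lift ord0 (enum_rank [ffun x => f x])) => x.
by rewrite ffunE liftK enum_rankK ffunE.
Qed.

(** * Recurrences and the schedule of vertical copies *)

Lemma bi_infinite_orbit (T : finType) (f : T -> T) (x0 : T) :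
  injective f -> exists u : int -> T, forall n, u (n + 1) = f (u n).
Proof.
move=> /injF_bij[g fK gK].
exists (fun n => match n with Posz m => iter m f x0 | Negz m => iter m.+1 g x0 end).
move=> [m|[|m]].
- by rewrite /= addn1.
- by rewrite /= gK.
- have -> : Negz m.+1 + 1 = Negz m by lia.
  by rewrite /= gK.
Qed.

(* The extreme coefficients 1 make the shift map of the recurrence invertible, hence
   solvable in both directions. *)
Lemma linear_recurrence_solvable (R : finNzRingType) (K : nat) (c : nat -> R) :
  c 0%N = 1 -> c K.+1 = 1 ->
  exists a : int -> R, forall n, \sum_(j < K.+2) c j * a (n + j%:Z) = 1.
Proof.
move=> c0 cK.
(* A state is a window of [K.+1] consecutive terms; [last] solves the equation for the next term,
   whose coefficient is 1. *)
pose last (v : {ffun 'I_K.+1 -> R}) := 1 - \sum_(j < K.+1) c j * v j.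
pose shift (v : {ffun 'I_K.+1 -> R}) : {ffun 'I_K.+1 -> R} :=
  [ffun j : 'I_K.+1 => if (j < K)%N then v (inord j.+1) else last v].
have shift_inj : injective shift.
  move=> v v' /ffunP Evv'.
  have ES (j : 'I_K) : v (lift ord0 j) = v' (lift ord0 j).
    have := Evv' (inord j); rewrite !ffunE inordK ?ltn_ord; last by rewrite ltnS ltnW.
    suff -> : inord j.+1 = lift ord0 j :> 'I_K.+1 by [].
    by apply: val_inj; rewrite /= inordK // ltnS.
  (* Once the other entries agree, equality of the new terms recovers entry 0, because [c 0 = 1]. *)
  have := Evv' ord_max; rewrite !ffunE /= ltnn /last !big_ord_recl c0 !mul1r.
  under eq_bigr => j _ do rewrite ES.
  move=> /addrI/oppr_inj/addIr E0; apply/ffunP=> j.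
  by have [l ->|->] := unliftP ord0 j.
have [u uS] := bi_infinite_orbit _ shift 0 shift_inj.
have uE j n : (j < K.+1)%N -> u n (inord j) = u (n + j%:Z) ord0.
  elim: j n => [|j IHj] n jK; first by rewrite addr0; congr (u n _); apply/val_inj/inordK.
  rewrite (_ : n + j.+1%:Z = n + 1 + j%:Z); last by lia.
  rewrite -IHj; last exact: ltnW.
  by rewrite uS ffunE inordK ?(ltnW jK) // -ltnS jK.
exists (fun n => u n ord0) => n; rewrite big_ord_recr /= cK mul1r.
have -> : u (n + K.+1%:Z) ord0 = last (u n).
  rewrite (_ : n + K.+1%:Z = n + 1 + K%:Z); last by lia.
  by rewrite -uE // uS ffunE inordK // ltnn.
rewrite /last (_ : \sum_(j < K.+1) c j * u n j = \sum_(j < K.+1) c j * u (n + j%:Z) ord0).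
  by rewrite addrC subrK.
by apply: eq_bigr => j _; rewrite -uE // inord_val.
Qed.
Lemma card_bigcup_disjoint (I T : finType) (P : pred I) (F : I -> {set T}) :
  (forall i j, P i -> P j -> i != j -> [disjoint F i & F j]) ->
  #|\bigcup_(i | P i) F i| = (\sum_(i | P i) #|F i|)%N.
Proof.
move=> disjF; rewrite big_mkcond [RHS]big_mkcond -sum1_card partition_disjoint_bigcup.
  by apply: eq_bigr => i _; case: (P i); rewrite sum1_card ?cards0.
move=> i j ij; case Pi: (P i); case Pj: (P j); rewrite ?disjF //.
all: by rewrite -setI_eq0 ?setI0 ?set0I.
Qed.

Lemma card_ord_lt (n m : nat) : (m <= n)%N -> #|[set j : 'I_n | (j < m)%N]| = m.
Proof.
move=> mn; rewrite -sum1_card; under eq_bigl => j do rewrite inE.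
by rewrite -(@big_ord_widen _ _ _ m n (fun=> 1%N) mn) sum1_card card_ord.
Qed.

(* [Y n] lists the columns in which a vertical copy of the tile starts at height [n]. *)
Lemma vertical_schedule (K i : nat) :
  (1 < K)%N -> (1 < i < K.+1)%N ->
  exists (I : finType) (Y : int -> {set I}),
    (forall n n' x, x \in Y n -> x \in Y n' -> (n = n' %[mod K.+1%:Z])%Z) /\
    (forall n : int, exists q,
      (\sum_(t < K.+1 | t.+1 != i) #|Y (n - t.+1%:Z)%R| = (q * K).+1)%N).
Proof.
case: K => [|[|q]] // _ iK.
(* Here [K = q.+2], so ['Z_q.+2] is the integers mod [K]. [c j] indicates that position [q.+3 - j]
   is in the tile; the extreme coefficients are 1 because [i] is neither 1 nor [K.+1]. *)
pose c j : 'Z_q.+2 := (q.+3 - j != i)%N%:R.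
have [||a aP] := linear_recurrence_solvable _ q.+1 c.
- by rewrite /c; case: eqP => //; lia.
- by rewrite /c; case: eqP => //; lia.
(* Columns are tagged by a residue mod [K.+1], so a column is reused only at congruent heights;
   [a n] is read as a number below [K]. *)
pose Y n := [set x : 'I_q.+3 * 'I_q.+2 | (x.1%:Z == (n %% q.+3)%Z) && (x.2 < a n)%N].
have cardY n : #|Y n| = a n.
  have n0 : 0 <= (n %% q.+3)%Z by exact: modz_ge0.
  have nq : (n %% q.+3)%Z < q.+3%:Z by exact: ltz_pmod.
  rewrite -[RHS](card_ord_lt q.+2); last exact: ltnW (ltn_ord (a n)).
  rewrite -[RHS]mul1n -(cards1 (inord `|(n %% q.+3)%Z|%N : 'I_q.+3)) -cardsX.
  apply: eq_card => x; rewrite !inE -val_eqE /= inordK; last by lia.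
  by congr (_ && _); lia.
exists ('I_q.+3 * 'I_q.+2)%type, Y; split=> [n n' x|n].
  by rewrite !inE => /andP[/eqP<- _] /andP[/eqP<- _].
set S := (X in exists q', X = _); exists (S %/ q.+2)%N.
suff S1 : (S %% q.+2 = 1)%N by rewrite [LHS](divn_eq S q.+2) S1 addn1.
rewrite -(val_Zp_nat (_ : 1 < q.+2)%N) //= /S natr_sum.
(* Position [t.+1] below height [n] corresponds to index [j = K - t] in the recurrence at
   [n - K.+1], hence the reversal. *)
rewrite [X in val X](_ : _ = 1) // -[RHS](aP (n - q.+3%:Z)) (reindex_inj rev_ord_inj) /=.
rewrite big_mkcond; apply: eq_bigr => j _; rewrite /c.
have jq := ltn_ord j.
have -> : (q.+3 - j.+1).+1 = (q.+3 - j)%N by lia.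
rewrite cardY natr_Zp -subzn ?(ltnW jq) // opprB addrA addrAC.
by case: eqP; rewrite ?mul0r ?mul1r.
Qed.

(** * Assembly of layers and vertical copies *)

Lemma universal_points_inj {d K} {I : finType} (s : I -> pt d.+1) p x y :
  (0 < K)%N -> (forall x, s x ord0 = 0) ->
  (forall f : I -> 'I_K.+1, exists j, forall x, s x j = (f x)%:Z) ->
  cong_on K.+1 [set~ ord0] (s x) p -> cong_on K.+1 [set~ ord0] (s y) p -> x = y.
Proof.
move=> K0 s0 s_univ /cong_onP px /cong_onP py; apply/eqP; apply: contraT => xy.
(* A coordinate equal to [K] at [x] and 0 at [y] separates their classes mod [K.+1]; it is not
   [ord0], where [s x] vanishes. *)
have [j sj] := s_univ (fun z => if z == x then ord_max else ord0).
have j0 : j \in [set~ ord0].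
  by rewrite !inE; apply: contraTneq K0 => j0; have := sj x; rewrite j0 s0 eqxx /=; lia.
have := px j j0; rewrite py // !sj eqxx eq_sym (negPf xy) /= !modz_small; lia.
Qed.

Lemma punctured_interval_tiles (K i : nat) :
  (1 < K)%N -> (1 < i < K.+1)%N -> exists d : nat, (0 < d)%N /\ tiles d (tile K.+1 i).
Proof.
move=> K1 iK; have [I [Y [Ymod Ysum]]] := vertical_schedule _ _ K1 iK.
have [d [s [s0 s_univ]]] := universal_points I K.
have K0 : (0 < K)%N by exact: ltnW.
have iK' : (0 < i <= K.+1)%N by lia.
exists d.+1; split=> //; apply: tileableT.
pose E : {set 'I_d.+1} := [set~ ord0].
(* [J n] collects the columns whose vertical copies meet height [n], [A n] is the layer at height
   [n] without them, and [Q] holds the starts of the vertical copies. *)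
pose J (n : int) := \bigcup_(t < K.+1 | t.+1 != i) Y (n - t.+1%:Z).
pose A (n : int) p := cube E [ffun=> n] p && [forall x in J n, ~~ cong_on K.+1 E (s x) p].
pose Q (b : pt d.+1) := exists2 x, x \in Y (b ord0) & cong_on K.+1 E (s x) b.
have off0 l : l \in E = (l != ord0) by rewrite !inE.
have AE n p : A n p -> p ord0 = n.
  by case/andP=> /cubeP/(_ ord0); rewrite off0 eqxx ffunE => ->.
have ApE (p : pt d.+1) : A (p ord0) p = [forall x in J (p ord0), ~~ cong_on K.+1 E (s x) p].
  rewrite /A (_ : cube _ _ _) //; apply/cubeP=> l.
  by rewrite off0 negbK => /eqP->; rewrite ffunE.
have cong_ext x (p p' : pt d.+1) : (forall l, l != ord0 -> p l = p' l) ->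
    cong_on K.+1 E (s x) p -> cong_on K.+1 E (s x) p'.
  by move=> pp' /cong_onP px; apply/cong_onP=> l lE; rewrite -pp' -?off0 // px.
apply: (tileable_ext (fun p => (exists n, A n p) \/
    (exists b, Q b /\ axis_copy (tile K.+1 i) ord0 b p))) => [p|].
  split=> // _; case: (boolP (A (p ord0) p)) => [Ap|]; first by left; exists (p ord0).
  rewrite ApE negb_forall_in => /exists_inP[x /bigcupP[t ti Yx]]; rewrite negbK => px.
  right; exists (upd p ord0 (p ord0 - t.+1%:Z)); split.
    exists x; first by rewrite upd_same.
    by apply: cong_ext px => l l0; rewrite upd_other.
  split=> [l l0|]; first by rewrite upd_other.
  rewrite upd_same opprB addrC subrK; have := ltn_ord t.
  by split; [lia | move=> Eti; case: Eti ti => ->; rewrite eqxx].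
apply: tileableU => [p [n Ap] [b [[x Yx bx] [pb [pb1 pbi]]]]||].
- move: (Ap); rewrite -(AE _ _ Ap) ApE => /forall_inP/(_ x) H.
  suff: ~~ cong_on K.+1 E (s x) p by rewrite (cong_ext _ _ _ _ bx) // => l /pb.
  apply: H; move: pb1 pbi; set h := (_ - _) => h1 hi.
  (* The copy meets [p] at position [h], so the index [h - 1] puts [x] in [J (p ord0)]. *)
  have hK : (`|h|.-1 < K.+1)%N by lia.
  apply/bigcupP; exists (Ordinal hK) => /=; first by apply/eqP; lia.
  suff -> : p ord0 - `|h|.-1.+1%:Z = b ord0 by [].
  have -> : `|h|.-1.+1%:Z = h by lia.
  by rewrite /h opprB addrC subrK.
- apply: tileable_bigU => [n n' p /AE<- /AE<- //|n].
  have [q Jq] := Ysum n; apply: (tileable_cubeD s E _ (J n) q iK' K0 s_univ).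
    by move=> j; rewrite off0 negbK => /eqP-> x y _ _; rewrite !s0.
  (* The sets [Y] in the union are disjoint: their heights differ by less than [K.+1], while a
     shared column forces congruence. *)
  rewrite -Jq card_bigcup_disjoint // => t t' _ _.
  apply: contraR => /pred0Pn[x /andP[/= Yt Yt']].
  have tK := ltn_ord t; have tK' := ltn_ord t'; apply/eqP/val_inj => /=.
  suff : n - t.+1%:Z = n - t'.+1%:Z by move=> /addrI/oppr_inj[].
  apply: eq_modz_small (Ymod _ _ _ Yt Yt') _; rewrite opprB addrA addrAC; lia.
- apply: tileable_axis_copies => p b b' [x Yx bx] [x' Yx' bx'] [pb tb] [pb' tb'].
  have Ex : x = x'.
    apply: (universal_points_inj s p x x' K0 s0 s_univ).
      by apply: cong_ext bx => l /pb.
    by apply: cong_ext bx' => l /pb'.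
  apply/ffunP=> l; have [->|l0] := eqVneq l ord0; last by rewrite -pb ?pb'.
  by apply: tile_start_inj tb tb' _; apply: Ymod Yx _; rewrite Ex.
Qed.

Theorem theorem2 (k i : nat) :
  (3 <= k)%N -> (2 <= i)%N -> (i <= k.-1)%N ->
  exists d : nat, (0 < d)%N /\ tiles d (tile k i).
Proof. by case: k => // K K2 i2 iK; apply: punctured_interval_tiles; lia. Qed.
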